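(* Consider either the full family or the trimmed family of basis functions. Let $K_+$, $K_-$ be two cells of the mesh that share the mesh face $F$. 1. A rotated function of $K_+$ owned by a mesh face $G\subseteq F$ is identified with exactly one rotated function of $K_-$, and that function is owned by $G$. 2. Identified rotated functions (of $K_+$ and $K_-$, owned by a mesh face $G \subseteq F$) have the same trace on $F$. 3. Rotated functions of $K_\pm$ owned by faces not contained in $F$ have zero trace on $F$. Consequently, the space assembled by the identification is $H\Lambda^1$-conforming.
   Context: Reference simplex. $D\ge1$, $r\ge1$ are integers, $\Delta = [v_0,\dots,v_D]\subset\mathbb{R}^D$ is a non-degenerate $D$-simplex with labels $0,\dots,D$, naturally ordered; its barycentric coordinates are denoted $\xi$ on a copy $\Delta_\xi$ and $\lambda$ on a copy $\Delta_\lambda$. Faces are identified with label sets $f\subseteq\{0,\dots,D\}$, $\dim f = |f|-1$, and all faces considered have $\dim\ge1$. For $\alpha\in\mathbb{N}_0^{D+1}$: $|\alpha| = \sum_i\alpha_i$, $\operatorname{supp}(\alpha) = \{i:\alpha_i>0\}$, $\mathbf{1}_\alpha$ is the 0/1 indicator vector of $\operatorname{supp}(\alpha)$, $b(\lambda;\alpha) = \prod_i\lambda_i^{\alpha_i}$. Full family: $\psi(\lambda;f,k,s) = \mathrm{d}\lambda_k - \frac{s_k}{|s|}\sum_{j\in f}\mathrm{d}\lambda_j$ for $k\in f$, $s\in\{0,1\}^{D+1}$, $\operatorname{supp}(s)\cup\{k\} = f$; it is anchored if $s_i = 0$ for all $i<\min(f\setminus\{k\})$. The basis index set $\mathcal{B}$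 consists of triplets $(f,k,\alpha)$ with $\dim f\ge1$, $k\in f$, $|\alpha| = r$, $\operatorname{supp}(\alpha)\cup\{k\} = f$, $\psi(\lambda;f,k,\mathbf{1}_\alpha)$ anchored, with form $w(\lambda;f,k,\alpha) = b(\lambda;\alpha)\psi(\lambda;f,k,\mathbf{1}_\alpha)$. Here write $\nu = (k,\alpha)$. Trimmed family: $\mathcal{B}$ consists of triplets $(f,e,\alpha)$ with $\dim f\ge1$, $e = (e_1,e_2)$ labels of $f$ with $e_1 = \min f<e_2$, $|\alpha| = r-1$, $\operatorname{supp}(\alpha)\cup\{e_1,e_2\} = f$, with form $w(\lambda;f,e,\alpha) = b(\lambda;\alpha)(\lambda_{e_1}\mathrm{d}\lambda_{e_2} - \lambda_{e_2}\mathrm{d}\lambda_{e_1})$. Here write $\nu = (e,\alpha)$. In both cases $\mathcal{B}_f$ denotes the set of $\nu$ such that $(f,\nu)\in\mathcal{B}$. Mesh and rotated bases. The mesh is a conforming simplicial mesh of $D$-simplices (cells), with globally (injectively) numbered vertices; a mesh face is identified with the set of global indices of its vertices. Each cell $K$ comes with an arbitrary local ordering of its vertices, given by $\operatorname{ltg}_K$, where $\operatorname{ltg}_K(i) = g_i$ is the global index of the vertex of $K$ with local label $i$. For a permutation $\pi$ of $\{0,\dots,D\}$ and a label set $f$, $\pi(f) = \{\pi(i): i\in f\}$; $\operatorname{ltg}_K$ of a label set is the set of images. $\pi_K\in S_{D+1}$ is the permutation such that $(g_{\pi_K^{-1}(0)},\dots,g_{\pi_K^{-1}(D)})$ is increasing.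 $\Phi_K:\Delta_\lambda\to K$ is the affine map sending the $j$-th vertex of $\Delta_\lambda$ to the vertex of $K$ with the $j$-th smallest global index. The rotated functions of $K$ are the pushforwards $(\Phi_K^{-1})^* w(\lambda;f,\nu)$, $(f,\nu)\in\mathcal{B}$. The rotated function $(f,\nu)$ of $K$ is owned by the mesh face $\operatorname{ltg}_K(\pi_K^{-1}(f))$, i.e. the face of $K$ whose vertices are those with positions $f$ in the increasing list of global indices of $K$. Position map and identification. For faces $f,f'$ of equal dimension, let $\sigma_{f\to f'}:f\to f'$ be the unique increasing bijection and $\iota_{f\to f'}:\mathcal{B}_f\to\mathcal{B}_{f'}$ the bijection relabelling $\nu$ by $\sigma_{f\to f'}$ (labels $k$, $e_1,e_2$ are mapped by $\sigma_{f\to f'}$, and the exponent $\alpha$, supported in $f$, is mapped to the exponent supported in $f'$ with entry $\alpha_i$ at $\sigma_{f\to f'}(i)$). A position map is a family of bijections $p_f:\mathcal{B}_f\to\{0,\dots,\#\mathcal{B}_f-1\}$ with $p_{f'}\circ\iota_{f\to f'} = p_f$ for all faces $f,f'$ of equal dimension; one such family is fixed. Rotated functions $(f_+,\nu_+)$ of $K_+$ and $(f_-,\nu_-)$ of $K_-$ are identified if $\operatorname{ltg}_{K_+}(\pi_{K_+}^{-1}(f_+)) = \operatorname{ltg}_{K_-}(\pi_{K_-}^{-1}(f_-))$ (same owning mesh face) and $p_{f_+}(\nu_+) = p_{f_-}(\nu_-)$. The assembled space is the span of the global basis functions obtained by gluing the identified rotated functions cell by cell (extended by zero on the other cells). The trace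 on a face $F$ is the pullback of a form by the inclusion of $F$; $H\Lambda^1$-conforming means that the trace of every function of the space on every face shared by two cells is single-valued. *)

(* Defs.v *)
From HB Require Import structures.
From mathcomp Require Import all_boot all_order all_fingroup all_algebra.
From mathcomp Require Import all_classical all_reals.
From mathcomp Require Import topology normedtype derive.

Set Implicit Arguments.
Unset Strict Implicit.
Unset Printing Implicit Defensive.

Import Order.TTheory GRing.Theory Num.Theory.
Import numFieldNormedType.Exports.
Local Open Scope ring_scope.

Section Simplex.
Variables (R : realType) (D : nat).
Implicit Types a b : 'I_D.+1 -> 'rV[R]_D.

(* [w x t] is the value at the point x on the tangent vector t. *)
Definition oneform := 'rV[R]_D -> 'rV[R]_D -> R.

(* Row j is (1, a_j); its determinant is D! times the signed volume. *)
Definition simplex_mx a : 'M[R]_D.+1 :=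
  \matrix_(i < D.+1) row_mx (1 : 'rV[R]_1) (a i).

Definition nondegenerate_simplex a := simplex_mx a \in unitmx.

(* The row of barycentric coordinates of x solves
   [\sum_j bary a j x *: (1, a_j) = (1, x)]; see [bary_sum], [bary_comb]. *)
Definition bary a (i : 'I_D.+1) (x : 'rV[R]_D) : R :=
  ((row_mx (1 : 'rV[R]_1) x : 'rV[R]_D.+1) *m invmx (simplex_mx a)) 0 i.

Definition dbary a (i : 'I_D.+1) : oneform := fun x t => 'd (bary a i) x t.

(* The affine map with [a j |-> b j]. *)
Definition simplex_map a b (x : 'rV[R]_D) : 'rV[R]_D :=
  \sum_j bary a j x *: b j.

Definition pullback (g : 'rV[R]_D -> 'rV[R]_D) (w : oneform) : oneform :=
  fun x t => w (g x) ('d g x t).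

Lemma bary_row a x : nondegenerate_simplex a ->
  \sum_j bary a j x *: row_mx (1 : 'rV[R]_1) (a j) = row_mx 1 x.
Proof.
move=> a_nd; set y : 'rV[R]_D.+1 := row_mx 1 x.
have yE : y = (y *m invmx (simplex_mx a)) *m simplex_mx a by rewrite mulmxKV.
rewrite [RHS]yE mulmx_sum_row; apply: eq_bigr => j _.
by rewrite rowK.
Qed.

Lemma bary_sum a x : nondegenerate_simplex a -> \sum_j bary a j x = 1.
Proof.
move=> /(bary_row x)/(congr1 (fun u : 'rV_(1 + D) => lsubmx u 0 0)).
rewrite row_mxKl; have -> : (1 : 'rV[R]_1) 0 0 = 1 by rewrite mxE eqxx.
move=> <-; rewrite linear_sum summxE.
by apply: eq_bigr => j _; rewrite linearZ /= row_mxKl !mxE mulr1.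
Qed.

Lemma bary_comb a x : nondegenerate_simplex a -> simplex_map a a x = x.
Proof.
move=> /(bary_row x)/(congr1 (fun u : 'rV_(1 + D) => rsubmx u)).
rewrite row_mxKr => {2}<-; rewrite linear_sum /=; apply: eq_bigr => j _.
by rewrite linearZ /= row_mxKr.
Qed.

Lemma bary_affine a (c : 'I_D.+1 -> R) b i : \sum_j c j = 1 ->
  bary a i (\sum_j c j *: b j) = \sum_j c j * bary a i (b j).
Proof.
move=> c1.
have rowE : row_mx (1 : 'rV[R]_1) (\sum_j c j *: b j)
          = \sum_j c j *: row_mx (1 : 'rV[R]_1) (b j).
  rewrite -[RHS]hsubmxK !linear_sum /=; congr row_mx.
    rewrite -[LHS]scale1r -c1 scaler_suml; apply: eq_bigr => j _.
    by rewrite linearZ /= row_mxKl.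
  by apply: eq_bigr => j _; rewrite linearZ /= row_mxKr.
rewrite /bary rowE; set P : 'M[R]_(1 + D) := invmx _.
transitivity ((\sum_j (c j *: row_mx (1 : 'rV[R]_1) (b j)) *m P) 0 i).
  by rewrite -mulmx_suml.
rewrite summxE; apply: eq_bigr => j _.
by rewrite -scalemxAl mxE.
Qed.

Lemma bary_vertex a i j : nondegenerate_simplex a -> bary a i (a j) = (i == j)%:R.
Proof.
move=> a_nd; rewrite /bary.
have -> : row_mx (1 : 'rV[R]_1) (a j) = row j (simplex_mx a) by rewrite rowK.
by rewrite -row_mul mulmxV // !mxE eq_sym.
Qed.

Lemma simplex_mapK a b : nondegenerate_simplex a -> nondegenerate_simplex b ->
  cancel (simplex_map a b) (simplex_map b a).
Proof.
move=> a_nd b_nd x; rewrite -[RHS](bary_comb x a_nd).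
apply: eq_bigr => i _; congr (_ *: _); rewrite bary_affine ?bary_sum//.
rewrite (bigD1 i)//= bary_vertex// eqxx mulr1 big1 ?addr0// => j ji.
by rewrite bary_vertex// eq_sym (negbTE ji) mulr0.
Qed.

End Simplex.

Section Families.
Variables (R : realType) (D r : nat).
Implicit Types (f : {set 'I_D.+1}) (v : 'I_D.+1 -> 'rV[R]_D).

(* Exponents of total degree at most r, so their entries fit in ['I_r.+1]. *)
Definition expo := {ffun 'I_D.+1 -> 'I_r.+1}.
Implicit Types al : expo.

Definition degree al : nat := \sum_i al i.
Definition supp al : {set 'I_D.+1} := [set i | (0 < al i)%N].
Definition indic al : {ffun 'I_D.+1 -> bool} := [ffun i => i \in supp al].

Definition bmono v al (x : 'rV[R]_D) : R := \prod_i bary v i x ^+ al i.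

(* [ord_max] is neutral for [min] on labels. *)
Definition face_min f : 'I_D.+1 := \big[Order.min/ord_max]_(i in f) i.

Definition psi v f (k : 'I_D.+1) (s : {ffun 'I_D.+1 -> bool}) : oneform R D :=
  fun x t => dbary v k x t
    - (s k)%:R / (\sum_i s i)%N%:R * \sum_(j in f) dbary v j x t.

Definition anchored f (k : 'I_D.+1) (s : {ffun 'I_D.+1 -> bool}) : bool :=
  [forall i : 'I_D.+1, (i < face_min (f :\ k))%N ==> ~~ s i].

Inductive form_family := Full | Trimmed.

Definition label (fam : form_family) : finType :=
  match fam with
  | Full => 'I_D.+1
  | Trimmed => ('I_D.+1 * 'I_D.+1)%type
  end.

Definition nu_index (fam : form_family) : finType := (label fam * expo)%type.

Definition in_basis fam f : nu_index fam -> bool :=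
  match fam return nu_index fam -> bool with
  | Full => fun nu => let: (k, al) := nu in
      [&& (1 < #|f|)%N, k \in f, degree al == r, k |: supp al == f
        & anchored f k (indic al)]
  | Trimmed => fun nu => let: ((e1, e2), al) := nu in
      [&& (1 < #|f|)%N, e1 == face_min f, (e1 < e2)%N, degree al == r.-1
        & supp al :|: [set e1; e2] == f]
  end.

Definition basis_at fam f : {set nu_index fam} := [set nu | in_basis f nu].

Definition face_index fam : finType := ({set 'I_D.+1} * nu_index fam)%type.

Definition basis_indices fam : {set face_index fam} :=
  [set q : face_index fam | q.2 \in basis_at fam q.1].

Definition basis_form v fam f : nu_index fam -> oneform R D :=
  match fam return nu_index fam -> oneform R D with
  | Full => fun nu => let: (k, al) := nu in
      fun x t => bmono v al x * psi v f k (indic al) x t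
  | Trimmed => fun nu => let: ((e1, e2), al) := nu in
      fun x t => bmono v al x
        * (bary v e1 x * dbary v e2 x t - bary v e2 x * dbary v e1 x t)
  end.

(* [enum f] lists f increasingly, so for #|f| = #|f'| this is the increasing
   bijection from f to f'; its values off f are irrelevant. *)
Definition sigma f f' (i : 'I_D.+1) : 'I_D.+1 :=
  nth ord0 (enum f') (index i (enum f)).

(* [sigma f' f] inverts [sigma f f'] on f'. *)
Definition relabel_expo f f' al : expo :=
  [ffun j => if j \in f' then al (sigma f' f j) else ord0].

Definition relabel fam f f' : nu_index fam -> nu_index fam :=
  match fam return nu_index fam -> nu_index fam with
  | Full => fun nu => let: (k, al) := nu in
      (sigma f f' k, relabel_expo f f' al)
  | Trimmed => fun nu => let: ((e1, e2), al) := nu in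
      ((sigma f f' e1, sigma f f' e2), relabel_expo f f' al)
  end.

Definition position_map fam (p : {set 'I_D.+1} -> nu_index fam -> nat) : Prop :=
  (forall f, (1 < #|f|)%N ->
     set_bij [set` basis_at fam f]%classic `I_#|basis_at fam f|%classic (p f)) /\
  (forall f f', (1 < #|f|)%N -> #|f| = #|f'| ->
     {in basis_at fam f, forall nu, p f' (relabel f f' nu) = p f nu}).

Lemma enum_sorted f : sorted (fun i j : 'I_D.+1 => i < j)%N (enum f).
Proof.
rewrite [enum f]/(enum_mem _) /=.
apply: sorted_filter; first by move=> ? ? ?; apply: ltn_trans.
have := iota_ltn_sorted 0 D.+1; rewrite -val_enum_ord sorted_map.
by rewrite enumT.
Qed.

Lemma sigma_in f f' i : #|f| = #|f'| -> i \in f -> sigma f f' i \in f'.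
Proof.
move=> ff' i_f; rewrite -mem_enum mem_nth// -cardE -ff' cardE index_mem.
by rewrite mem_enum.
Qed.

Lemma sigmaK f f' : #|f| = #|f'| -> {in f, cancel (sigma f f') (sigma f' f)}.
Proof.
move=> ff' i i_f; rewrite /sigma index_uniq ?enum_uniq//.
  by rewrite nth_index// mem_enum.
by rewrite -cardE -ff' cardE index_mem mem_enum.
Qed.

Lemma sigma_incr f f' : #|f| = #|f'| ->
  {in f &, forall i j : 'I_D.+1, (i < j)%N -> (sigma f f' i < sigma f f' j)%N}.
Proof.
move=> ff' i j i_f j_f ij.
have szi (g h : {set 'I_D.+1}) (l : 'I_D.+1) : #|g| = #|h| -> l \in g ->
    (index l (enum g) < size (enum h))%N.
  by move=> gh lg; rewrite -cardE -gh cardE index_mem mem_enum.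
have tr : transitive (fun i j : 'I_D.+1 => i < j)%N.
  by move=> ? ? ?; apply: ltn_trans.
apply: (sorted_ltn_nth tr ord0 (enum_sorted f')); rewrite ?inE ?szi//.
apply: contraTT ij; rewrite -!leqNgt leq_eqVlt => /orP[/eqP jiE|ji].
  have -> : j = i; last by [].
  by rewrite -(nth_index ord0 (s := enum f) (x := j)) ?mem_enum// jiE
             nth_index// mem_enum.
have := sorted_ltn_nth tr ord0 (enum_sorted f)
  (index j (enum f)) (index i (enum f)).
by rewrite !inE !szi// !nth_index ?mem_enum// => /(_ isT isT ji)/ltnW.
Qed.

End Families.

Section Mesh.
Variables (R : realType) (D : nat).

(* Vertices are identified with their global indices; [ltg K] is the local
   numbering of the vertices of the cell K. *)
Record mesh := Mesh {
  nvert : nat;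
  pt : 'I_nvert -> 'rV[R]_D;
  cell : finType;
  ltg : cell -> 'I_D.+1 -> 'I_nvert
}.

Variable M : mesh.
Implicit Types (K : cell M) (F : {set 'I_(nvert M)}).

Definition cell_verts K : {set 'I_(nvert M)} := [set ltg K i | i : 'I_D.+1].

Definition hull F : set 'rV[R]_D :=
  [set x | exists c : 'I_(nvert M) -> R,
     [/\ forall g, 0 <= c g, \sum_(g in F) c g = 1
       & x = \sum_(g in F) c g *: pt g]]%classic.

Definition tangent F : {vspace 'rV[R]_D} :=
  <<[seq pt g - pt h | g <- enum F, h <- enum F]>>%VS.

(* Since [hull set0 = set0], the last clause says that two cells are disjoint
   or meet exactly in the face spanned by their common vertices. *)
Definition conforming_mesh : Prop :=
  [/\ injective (@pt M),
      forall K, injective (ltg K),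
      forall K, nondegenerate_simplex (@pt M \o ltg K),
      injective cell_verts
    & forall K K', (hull (cell_verts K) `&` hull (cell_verts K'))%classic
                   = hull (cell_verts K :&: cell_verts K')].

Definition shared_face F K K' : Prop :=
  [/\ (1 < #|F|)%N, F \subset cell_verts K & F \subset cell_verts K'].

Definition sorts K (s : {perm 'I_D.+1}) : bool :=
  [forall i : 'I_D.+1, forall j : 'I_D.+1,
     (i < j)%N ==> (ltg K (s^-1%g i) < ltg K (s^-1%g j))%N].

(* The only permutation satisfying [sorts K], see [sort_permP]. *)
Definition sort_perm K : {perm 'I_D.+1} := odflt 1%g [pick s | sorts K s].

Definition sorted_pt K (j : 'I_D.+1) : 'rV[R]_D :=
  pt (ltg K ((sort_perm K)^-1%g j)).

(* Pullback by the inclusion of F: base points restricted to F, vectors to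
   its tangent space. *)
Definition trace F (w : oneform R D) :
    {x | hull F x} -> subvs_of (tangent F) -> R :=
  fun x t => w (sval x) (vsval t).
#[local] Arguments trace : clear implicits.

Section Rotated.
Variables (r : nat) (v : 'I_D.+1 -> 'rV[R]_D) (fam : form_family).
Variable p : {set 'I_D.+1} -> nu_index D r fam -> nat.
Implicit Types q : face_index D r fam.

Definition Phi K := simplex_map v (sorted_pt K).

(* The inverse of [Phi K], see [simplex_mapK]. *)
Definition PhiV K := simplex_map (sorted_pt K) v.

(* Given by its polynomial expression on the whole space; only its restriction
   to K is meaningful. *)
Definition rotated K q : oneform R D :=
  pullback (PhiV K) (basis_form v q.1 q.2).

Definition owner K q : {set 'I_(nvert M)} :=
  [set ltg K i | i in [set (sort_perm K)^-1%g j | j in q.1]].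

Definition identified K q K' q' : bool :=
  (owner K q == owner K' q') && (p q.1 q.2 == p q'.1 q'.2).

(* Cellwise form, two-valued on common faces; the component on K matters only
   on K. *)
Definition broken_form := cell M -> oneform R D.

Definition global_basis K0 q0 : broken_form := fun K =>
  if [pick q in basis_indices D r fam | identified K0 q0 K q] is Some q
  then rotated K q else fun _ _ => 0.

Definition assembled : set broken_form :=
  [set u | exists c : cell M -> face_index D r fam -> R,
     u = fun K x t => \sum_K0 \sum_(q0 in basis_indices D r fam)
                        c K0 q0 * global_basis K0 q0 K x t]%classic.

End Rotated.

Definition HLambda1_conforming (V : set broken_form) : Prop :=
  forall u, V u -> forall K K' F, K != K' -> shared_face F K K' ->
    trace F (u K) = trace F (u K').

Lemma sort_permP K : injective (ltg K) ->
  sorts K (sort_perm K) /\ forall s, sorts K s -> s = sort_perm K.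
Proof.
move=> ltg_inj.
have ex : exists s, sorts K s.
  pose le : rel 'I_D.+1 := fun i j => (ltg K i <= ltg K j)%N.
  pose l := sort le (enum 'I_D.+1).
  have le_tr : transitive le by move=> ? ? ?; apply: leq_trans.
  have l_sorted : sorted le l by apply: sort_sorted => i j; apply: leq_total.
  have l_size : size l = D.+1 by rewrite size_sort size_enum_ord.
  have l_uniq : uniq l by rewrite sort_uniq enum_uniq.
  have t_inj : injective (fun i : 'I_D.+1 => nth ord0 l i).
    by move=> i j /eqP; rewrite nth_uniq ?l_size// => /eqP/val_inj.
  exists (perm t_inj)^-1%g; apply/forallP => i; apply/forallP => j.
  apply/implyP => ij; rewrite invgK !permE ltn_neqAle; apply/andP; split.
    by apply: contraTneq ij => /val_inj/ltg_inj/t_inj ->; rewrite ltnn.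
  by apply: (sorted_ltn_nth le_tr ord0 l_sorted) => //; rewrite inE l_size.
have sorts_uniq s t : sorts K s -> sorts K t -> s = t.
  move=> sK tK; apply: invg_inj.
  have cnt (u : {perm 'I_D.+1}) (i : 'I_D.+1) : sorts K u ->
      #|[set k | (ltg K k < ltg K (u^-1%g i))%N]| = i.
    move=> uK; have uE (a b : 'I_D.+1) :
        (ltg K (u^-1%g a) < ltg K (u^-1%g b))%N = (a < b)%N.
      have uP (x y : 'I_D.+1) : (x < y)%N ->
          (ltg K (u^-1%g x) < ltg K (u^-1%g y))%N.
        by move: uK => /forallP/(_ x)/forallP/(_ y)/implyP.
      case: (ltngtP a b) => [/uP//|/uP ba|/val_inj->]; last by rewrite ltnn.
      by apply/negbTE; rewrite -leqNgt ltnW.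
    rewrite -(card_imset _ (@perm_inj _ u)).
    have -> : [set u x | x in [set k | (ltg K k < ltg K (u^-1%g i))%N]]
            = [set k : 'I_D.+1 | (k < i)%N].
      apply/setP => k; rewrite -[k in LHS](permKV u) mem_imset; last first.
        exact: perm_inj.
      by rewrite !inE uE.
    rewrite cardsE -sum1_card (big_ord_narrow (ltnW (ltn_ord i))).
    by rewrite sum1_card card_ord.
  apply/permP => i; apply: ltg_inj; apply/val_inj/eqP.
  rewrite eqn_leq; apply/andP; split; rewrite leqNgt; apply/negP => lt.
    have : (#|[set k | (ltg K k < ltg K (t^-1%g i))%N]|
         < #|[set k | (ltg K k < ltg K (s^-1%g i))%N]|)%N.
      apply/proper_card/properP; split.
        by apply/fintype.subsetP => k; rewrite !inE => /ltn_trans; apply.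
      by exists (t^-1%g i); rewrite inE ?ltnn.
    by rewrite !cnt// ltnn.
  have : (#|[set k | (ltg K k < ltg K (s^-1%g i))%N]|
       < #|[set k | (ltg K k < ltg K (t^-1%g i))%N]|)%N.
    apply/proper_card/properP; split.
      by apply/fintype.subsetP => k; rewrite !inE => /ltn_trans; apply.
    by exists (s^-1%g i); rewrite inE ?ltnn.
  by rewrite !cnt// ltnn.
rewrite /sort_perm; case: pickP => [s sK|no]; last first.
  by case: ex => s; rewrite no.
by split=> //= t tK; apply: sorts_uniq.
Qed.

End Mesh.

Arguments trace {R D M} F w _ _.
Arguments assembled {R D} M {r} v {fam} p _.

(* Main.v *)
(* On a face F of K, write a point and a tangent vector as combinations of the
   vertices of F, with coefficients c of sum 1 and d of sum 0. Each rotated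
   function of K is then one fixed polynomial in the barycentric coordinates of
   K and their differentials, and the coordinate of a vertex g is c g or d g if
   g lies in F, and 0 otherwise. A function owned by a face not contained in F
   has a vanishing coordinate at a vertex of its owner, which annihilates the
   form. Because every cell sorts its vertices by global index, the increasing
   bijection between the positions of a common face in two cells matches equal
   vertices; hence the relabelled function has the same trace, and the position
   map identifies exactly the relabelled functions. *)

From HB Require Import structures.
Require Import Defs.
From mathcomp Require Import all_boot all_order all_fingroup all_algebra.
From mathcomp Require Import all_classical all_reals.
From mathcomp Require Import topology normedtype derive.

Set Implicit Arguments.
Unset Strict Implicit.
Unset Printing Implicit Defensive.

Import Order.TTheory GRing.Theory Num.Theory.
Import numFieldNormedType.Exports.
Local Open Scope ring_scope.

(** * Differentials of affine maps and barycentric coordinates *)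

Lemma rV_linear_continuous (R : realType) (n : nat) (V : normedModType R)
    (L : 'rV[R]_n -> V) : linear L -> continuous L.
Proof.
move=> linL.
pose L' : {linear 'rV[R]_n -> V} :=
  HB.pack L (GRing.isLinear.Build R _ V *:%R L linL).
(* The expansion in the standard basis makes [L] a finite sum of coordinates times fixed vectors. *)
have LE : L = fun x => \sum_i x 0 i *: L (delta_mx 0 i).
  apply/funext => x; rewrite {1}(row_sum_delta x).
  have -> : forall y, L y = L' y by [].
  by rewrite linear_sum; apply: eq_bigr => i _; rewrite linearZ.
rewrite LE; apply: continuous_big => [|i _ x]; first exact: add_continuous.
by apply: (@cvgZr_tmp _ _ _ (nbhs x)); apply: coord_continuous.
Qed.

(** The constant has zero differential, and the linear part, being continuous, is its own
    differential. *)
Lemma diff_affine (R : realType) (n : nat) (V : normedModType R)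
    (g L : 'rV[R]_n -> V) (c : V) (x t : 'rV[R]_n) :
  linear L -> (forall y, g y = c + L y) -> 'd g x t = L t.
Proof.
move=> linL gE; have contL := rV_linear_continuous linL.
pose L' : {linear 'rV[R]_n -> V} :=
  HB.pack L (GRing.isLinear.Build R _ V *:%R L linL).
have -> : g = cst c + (L' : _ -> _) by apply/funext => y; rewrite gE.
rewrite diffD; [|exact: differentiable_cst|exact: linear_differentiable].
by rewrite diff_cst /= add0r (diff_lin x (f := L') contL).
Qed.

(** The linear part of [bary a i]: the row (1, x) becomes (0, t). By [dbaryE] it is the differential
    of [bary a i] at every point. *)
Definition bary_lin (R : realType) (D : nat) (a : 'I_D.+1 -> 'rV[R]_D)
    (i : 'I_D.+1) (t : 'rV[R]_D) : R :=
  ((row_mx (0 : 'rV[R]_1) t : 'rV[R]_D.+1) *m invmx (simplex_mx a)) 0 i.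

Section BaryLin.
Variables (R : realType) (D : nat).
Implicit Types a b : 'I_D.+1 -> 'rV[R]_D.

Lemma bary_lin_linear a i : linear (bary_lin a i : 'rV[R]_D -> R^o).
Proof.
move=> k s t; rewrite /bary_lin.
have -> : row_mx (0 : 'rV[R]_1) (k *: s + t)
        = k *: row_mx (0 : 'rV[R]_1) s + row_mx (0 : 'rV[R]_1) t.
  by rewrite scale_row_mx add_row_mx scaler0 addr0.
set P : 'M[R]_(1 + D) := invmx _.
change ((((k *: row_mx (0 : 'rV[R]_1) s + row_mx (0 : 'rV[R]_1) t) *m P) 0 i : R)
   = k * (row_mx (0 : 'rV[R]_1) s *m P) 0 i
     + (row_mx (0 : 'rV[R]_1) t *m P) 0 i).
by rewrite mulmxDl -scalemxAl 2!mxE.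
Qed.

Lemma bary_split a i x : bary a i x = bary a i 0 + bary_lin a i x.
Proof.
rewrite /bary /bary_lin; set P : 'M[R]_(1 + D) := invmx _.
have -> : row_mx (1 : 'rV[R]_1) x = row_mx 1 0 + row_mx 0 x.
  by rewrite add_row_mx addr0 add0r.
change ((((row_mx (1 : 'rV[R]_1) 0 + row_mx (0 : 'rV[R]_1) x) *m P) 0 i : R)
   = (row_mx (1 : 'rV[R]_1) 0 *m P) 0 i
     + (row_mx (0 : 'rV[R]_1) x *m P) 0 i).
by rewrite mulmxDl mxE.
Qed.

Lemma dbaryE a i x t : dbary a i x t = bary_lin a i t.
Proof.
exact: (diff_affine x t (bary_lin_linear a i) (bary_split a i)).
Qed.

Lemma diff_simplex_map a b x t :
  'd (simplex_map a b) x t = \sum_j bary_lin a j t *: b j.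
Proof.
apply: (diff_affine (L := fun t => \sum_j bary_lin a j t *: b j)
          (c := \sum_j bary a j 0 *: b j)) => [k s u|y].
  rewrite scaler_sumr -big_split; apply: eq_bigr => j _ /=.
  by rewrite [bary_lin a j _]bary_lin_linear scalerDl scalerA.
rewrite -big_split; apply: eq_bigr => j _.
by rewrite bary_split scalerDl.
Qed.

(** The row on the left is the coefficient row times [simplex_mx a], which the inverse cancels. The
    total stays free, so that total 1 covers points and total 0 covers tangent vectors. *)
Lemma row_simplex_coord a (c : 'I_D.+1 -> R) i : nondegenerate_simplex a ->
  ((row_mx (\sum_j c j)%:M (\sum_j c j *: a j) : 'rV[R]_(1 + D))
     *m (invmx (simplex_mx a) : 'M[R]_(1 + D))) 0 i = c i.
Proof.
move=> a_nd.
have -> : row_mx (\sum_j c j)%:M (\sum_j c j *: a j)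
        = (\row_j c j : 'rV[R]_D.+1) *m simplex_mx a.
  rewrite mulmx_sum_row.
  rewrite -[RHS](@hsubmxK _ _ 1 D) !linear_sum /=; congr row_mx.
    rewrite raddf_sum; apply: eq_bigr => j _; rewrite mxE rowK linearZ /= row_mxKl.
    by rewrite scalemx1.
  by apply: eq_bigr => j _; rewrite mxE rowK linearZ /= row_mxKr.
by rewrite mulmxK // mxE.
Qed.

Lemma bary_coord a (c : 'I_D.+1 -> R) i : nondegenerate_simplex a ->
  \sum_j c j = 1 -> bary a i (\sum_j c j *: a j) = c i.
Proof.
by move=> a_nd c1; rewrite -[RHS](row_simplex_coord c i a_nd) c1.
Qed.

Lemma bary_lin_coord a (c : 'I_D.+1 -> R) i : nondegenerate_simplex a ->
  \sum_j c j = 0 -> bary_lin a i (\sum_j c j *: a j) = c i.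
Proof.
by move=> a_nd c0; rewrite -[RHS](row_simplex_coord c i a_nd) c0 raddf0.
Qed.
End BaryLin.

(** * Relabelling along increasing bijections of faces *)

Section Relabelling.
Variables (D r : nat).
Implicit Types (f g : {set 'I_D.+1}) (al : expo D r) (fam : form_family).

Lemma face_min_in f i : i \in f -> face_min f \in f.
Proof.
move=> i_f; rewrite /face_min.
(* [ord_max] bounds every label, so the minimum over the nonempty [f] is attained in [f]. *)
have [|j j_f ->] := eq_bigmin (x := ord_max) i (mem f) id i_f; last exact: j_f.
by move=> j _; rewrite leEord -ltnS.
Qed.

Lemma face_min_le f i : i \in f -> (face_min f <= i)%N.
Proof. by move=> i_f; apply: (@bigmin_le_cond _ 'I_D.+1 _ ord_max i (mem f) id). Qed.

Lemma sigma_inj f f' : #|f| = #|f'| -> {in f &, injective (sigma f f')}.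
Proof. by move=> ff'; apply: can_in_inj (sigmaK ff'). Qed.

Lemma sigma_image f f' : #|f| = #|f'| -> sigma f f' @: f = f'.
Proof.
move=> ff'; apply/eqP; rewrite eqEcard card_in_imset ?ff' ?leqnn ?andbT.
  by apply/fintype.subsetP => _ /imsetP[i i_f ->]; apply: sigma_in.
exact: sigma_inj.
Qed.

Lemma sigma_leq f f' : #|f| = #|f'| ->
  {in f &, forall i j : 'I_D.+1, (i <= j)%N -> (sigma f f' i <= sigma f f' j)%N}.
Proof.
move=> ff' i j i_f j_f; rewrite leq_eqVlt => /orP[/eqP/val_inj->//|ij].
by rewrite ltnW// sigma_incr.
Qed.

(** A map that is monotone on [f] carries a least element of [g] to a least element of the image;
    [i] witnesses that [g] is nonempty. *)
Lemma face_min_sigma f f' g i : #|f| = #|f'| -> g \subset f -> i \in g ->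
  face_min (sigma f f' @: g) = sigma f f' (face_min g).
Proof.
move=> ff' /fintype.subsetP gf i_g; apply/val_inj/eqP; have m_g := face_min_in i_g.
rewrite eqn_leq face_min_le ?imset_f//=.
have /imsetP[j j_g ->] := face_min_in (imset_f (sigma f f') i_g).
by apply: sigma_leq; rewrite ?gf// face_min_le.
Qed.

Lemma suppPn al i : reflect (al i = 0%N :> nat) (i \notin supp al).
Proof. by rewrite inE -eqn0Ngt; apply: eqP. Qed.

Lemma relabel_expo_sigma f f' al i : #|f| = #|f'| -> i \in f ->
  relabel_expo f f' al (sigma f f' i) = al i.
Proof. by move=> ff' i_f; rewrite ffunE sigma_in// sigmaK. Qed.

Lemma supp_relabel f f' al : #|f| = #|f'| -> supp al \subset f ->
  supp (relabel_expo f f' al) = sigma f f' @: supp al.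
Proof.
move=> ff' /fintype.subsetP alf; apply/setP => j; rewrite inE.
apply/idP/imsetP => [|[i i_al ->]]; last first.
  by rewrite relabel_expo_sigma ?alf//; rewrite inE in i_al.
rewrite ffunE; case: ifP => // j_f' al_gt0.
by exists (sigma f' f j); rewrite ?inE// sigmaK.
Qed.

Lemma big_sigma (R : Type) (idx : R) (op : Monoid.com_law idx) f f'
    (h : 'I_D.+1 -> R) : #|f| = #|f'| ->
  \big[op/idx]_(j in f') h j = \big[op/idx]_(i in f) h (sigma f f' i).
Proof.
by move=> ff'; rewrite -{1}(sigma_image ff') big_imset//; apply: sigma_inj.
Qed.

Lemma big_supp (R : Type) (idx : R) (op : Monoid.com_law idx) f al
    (h : 'I_D.+1 -> nat -> R) : supp al \subset f -> (forall i, h i 0%N = idx) ->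
  \big[op/idx]_i h i (al i) = \big[op/idx]_(i in f) h i (al i).
Proof.
move=> /fintype.subsetP alf h0; rewrite [RHS]big_mkcond; apply: eq_bigr => i _.
by case: ifPn => // /(contra (alf i))/suppPn->.
Qed.

(** Common source for the degree, the monomial and the size of the support: exponent 0 contributes
    the neutral element, so both sides reduce to the faces, where [sigma f f'] matches the terms. *)
Lemma big_relabel (R : Type) (idx : R) (op : Monoid.com_law idx) f f' al
    (h h' : 'I_D.+1 -> nat -> R) :
  #|f| = #|f'| -> supp al \subset f -> (forall i, h i 0%N = idx) ->
  (forall j, h' j 0%N = idx) ->
  {in f, forall i, h' (sigma f f' i) =1 h i} ->
  \big[op/idx]_j h' j (relabel_expo f f' al j) = \big[op/idx]_i h i (al i).
Proof.
move=> ff' alf h0 h'0 hh'; rewrite (big_supp _ alf h0) (@big_supp _ _ _ f')//.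
  rewrite (big_sigma _ _ ff'); apply: eq_bigr => i i_f.
  by rewrite relabel_expo_sigma// hh'.
by rewrite supp_relabel// -{2}(sigma_image ff') imsetS.
Qed.

Lemma degree_relabel f f' al : #|f| = #|f'| -> supp al \subset f ->
  degree (relabel_expo f f' al) = degree al.
Proof.
by move=> ff' alf; apply: (@big_relabel _ _ _ _ _ _ (fun=> id) (fun=> id)).
Qed.

Lemma anchoredP f k (al : expo D r) :
  reflect {in supp al, forall i : 'I_D.+1, face_min (f :\ k) <= i}%N
          (anchored f k (indic al)).
Proof.
apply: (iffP forallP) => [anc i i_al|anc i].
  by rewrite leqNgt; apply: contraL i_al => /(implyP (anc i)); rewrite ffunE.
by apply/implyP; rewrite ffunE; apply: contraTN => /anc; rewrite leqNgt.
Qed.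

(** The conditions on a basis index involve only cardinality, degree, supports and the order of
    labels of [f], all preserved by an increasing bijection. For anchoring, [sigma f f'] carries
    [f :\ k] onto its counterpart in [f'], hence minimum to minimum. *)
Lemma relabel_basis fam f f' (nu : nu_index D r fam) : #|f| = #|f'| ->
  nu \in basis_at r fam f -> relabel f f' nu \in basis_at r fam f'.
Proof.
move=> ff'; rewrite /basis_at !inE; case: fam nu => [[k al]|[[e1 e2] al]] /=.
  case/and5P=> f_gt1 k_f deg /eqP fE /anchoredP anc.
  have alf : supp al \subset f by rewrite -fE finset.subsetUr.
  rewrite -ff' f_gt1 sigma_in// degree_relabel// deg supp_relabel//=.
  rewrite -imset_set1 -imsetU fE sigma_image// eqxx /=.
  apply/anchoredP; rewrite supp_relabel// => _ /imsetP[i i_al ->].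
  (* A face of dimension at least 1 has a label besides [k], so the minimum in the anchoring
     condition is not the default [ord_max]. *)
  have [j j_fk] : exists j, j \in f :\ k.
    by apply/set0Pn; rewrite -card_gt0; move: f_gt1; rewrite (cardsD1 k) k_f.
  have -> : f' :\ sigma f f' k = sigma f f' @: (f :\ k).
    apply/setP => l; apply/setD1P/imsetP => [[lk l_f']|[m /setD1P[mk m_f] ->]].
      exists (sigma f' f l); last by rewrite sigmaK.
      rewrite in_setD1 sigma_in// andbT; apply: contra_neq lk => <-.
      by rewrite sigmaK.
    by rewrite sigma_in// (inj_in_eq (sigma_inj ff')).
  have sub := subD1set f k.
  rewrite (face_min_sigma ff' sub j_fk) sigma_leq ?anc//.
    exact: (fintype.subsetP sub) (face_min_in j_fk).
  exact: (fintype.subsetP alf).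
case/and5P=> f_gt1 /eqP e1E e12 deg /eqP fE.
have alf : supp al \subset f by rewrite -fE finset.subsetUl.
have [e1_f e2_f] : e1 \in f /\ e2 \in f by rewrite -fE !inE !eqxx !orbT.
rewrite -ff' f_gt1 degree_relabel// deg supp_relabel// sigma_incr//=.
rewrite -!imset_set1 -!imsetU fE sigma_image// eqxx !andbT /=.
by rewrite {1}e1E -{2}(sigma_image ff') (face_min_sigma ff' (subxx f) e1_f).
Qed.

Lemma supp_basis fam f (nu : nu_index D r fam) :
  nu \in basis_at r fam f -> supp nu.2 \subset f.
Proof.
rewrite inE; case: fam nu => [[k al]|[[e1 e2] al]] /= /and5P[].
  by move=> _ _ _ /eqP <- _; rewrite finset.subsetUr.
by move=> _ _ _ _ /eqP <-; rewrite finset.subsetUl.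
Qed.

End Relabelling.

(* The value of a basis form at a point with barycentric coordinates [B] on a
   tangent vector on which the differentials of these coordinates are [T]. *)
Definition coord_form (R : realType) (D r : nat) (B T : 'I_D.+1 -> R) fam
    (f : {set 'I_D.+1}) : nu_index D r fam -> R :=
  match fam return nu_index D r fam -> R with
  | Full => fun nu => let: (k, al) := nu in
      (\prod_i B i ^+ al i)
        * (T k - (indic al k)%:R / (\sum_i indic al i)%N%:R * \sum_(j in f) T j)
  | Trimmed => fun nu => let: ((e1, e2), al) := nu in
      (\prod_i B i ^+ al i) * (B e1 * T e2 - B e2 * T e1)
  end.

(** * Basis forms as polynomials in coordinates and differentials *)

Section CoordForm.
Variables (R : realType) (D r : nat) (fam : form_family).
Implicit Types (f : {set 'I_D.+1}) (nu : nu_index D r fam).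

Lemma basis_formE v f nu x t :
  basis_form v f nu x t
  = coord_form (fun i => bary v i x) (fun i => dbary v i x t) f nu :> R.
Proof. by case: fam nu => [[k al]|[[e1 e2] al]]. Qed.

(** The exponent vanishes off [f], and the other labels in the formula lie in [f]. So the value
    depends only on [B] and [T] over [f], which [sigma f f'] transports. *)
Lemma coord_form_relabel f f' (B T B' T' : 'I_D.+1 -> R) nu :
  #|f| = #|f'| -> nu \in basis_at r fam f ->
  {in f, forall i, B' (sigma f f' i) = B i} ->
  {in f, forall i, T' (sigma f f' i) = T i} ->
  coord_form B' T' f' (relabel f f' nu) = coord_form B T f nu.
Proof.
move=> ff' nuB BE TE; have alf := supp_basis nuB; move: nuB; rewrite inE.
case: fam nu alf => [[k al]|[[e1 e2] al]] /= alf.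
  case/and5P=> _ k_f _ _ _; congr (_ * (_ - _ / _ * _)).
  - apply: (@big_relabel _ _ _ _ _ _ _ _ (fun i n => B i ^+ n)
              (fun i n => B' i ^+ n)) => // i i_f n.
    by rewrite BE.
  - exact: TE.
  - by rewrite !ffunE !inE relabel_expo_sigma.
  - congr _%:R.
    transitivity (\sum_i (0 < relabel_expo f f' al i))%N.
      by apply: eq_bigr => i _; rewrite ffunE inE.
    rewrite (@big_relabel _ _ _ _ _ _ _ _ (fun i n => (0 < n)%N : nat)
                (fun i n => (0 < n)%N : nat))//.
    by apply: eq_bigr => i _; rewrite [in RHS]ffunE inE.
  - by rewrite (big_sigma _ _ ff'); apply: eq_bigr.
case/and5P=> _ _ _ _ /eqP fE.
have [e1_f e2_f] : e1 \in f /\ e2 \in f by rewrite -fE !inE !eqxx !orbT.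
rewrite !BE// !TE//; congr (_ * _).
apply: (@big_relabel _ _ _ _ _ _ _ _ (fun i n => B i ^+ n)
          (fun i n => B' i ^+ n)) => // i i_f n.
by rewrite BE.
Qed.

(** A label of [f] lies in the support of the exponent, where the monomial vanishes, or is one of
    the labels [k], [e1], [e2], where the other factor can take over. In the trimmed case both terms
    of that factor contain [B j] or [T j]. *)
Lemma coord_form_eq0 f (B T : 'I_D.+1 -> R) nu j :
  nu \in basis_at r fam f -> j \in f -> B j = 0 -> T j = 0 ->
  coord_form B T f nu = 0.
Proof.
have prod0 (al : expo D r) l :
    l \in supp al -> B l = 0 -> \prod_i B i ^+ al i = 0.
  rewrite inE => al_l Bl.
  by rewrite (bigD1 l)//= Bl expr0n eqn0Ngt al_l mul0r.
rewrite inE; case: fam nu => [[k al]|[[e1 e2] al]] /= /and5P[].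
  move=> _ _ _ /eqP <- _; rewrite in_setU1 => /orP[/eqP -> Bk Tk|jal Bj _].
    have [kal|knal] := boolP (k \in supp al).
      by rewrite (prod0 _ k)// mul0r.
    (* Off the support the indicator at [k] is 0, so psi reduces to the differential of coordinate
       [k], which is [T k = 0]. *)
    by rewrite Tk ffunE (negbTE knal) mul0r mul0r subr0 mulr0.
  by rewrite (prod0 _ j)// mul0r.
move=> _ _ _ _ /eqP <-; rewrite finset.in_setU => /orP[jal Bj _|].
  by rewrite (prod0 _ j)// mul0r.
by rewrite !inE => /orP[]/eqP <- -> ->; rewrite !(mul0r, mulr0) subr0 mulr0.
Qed.

End CoordForm.

(** * Cell vertices in increasing global order, and face tangents *)

Section SortedVertices.
Variables (R : realType) (D : nat) (M : mesh R D).
Hypothesis M_conf : conforming_mesh M.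
Implicit Types (K : cell M) (F : {set 'I_(nvert M)}) (f : {set 'I_D.+1}).

Definition sorted_vtx K (j : 'I_D.+1) : 'I_(nvert M) :=
  ltg K ((sort_perm K)^-1%g j).

Lemma sorted_vtx_ltn K (i j : 'I_D.+1) :
  (i < j)%N -> (sorted_vtx K i < sorted_vtx K j)%N.
Proof.
case: M_conf => _ ltg_inj _ _ _.
have [sK _] := sort_permP (ltg_inj K).
by move: sK => /forallP/(_ i)/forallP/(_ j)/implyP.
Qed.

Lemma sorted_vtx_inj K : injective (sorted_vtx K).
Proof.
by case: M_conf => _ ltg_inj _ _ _ i j /ltg_inj/perm_inj.
Qed.

Lemma sorted_pt_nondegenerate K : nondegenerate_simplex (sorted_pt K).
Proof.
case: M_conf => _ _ /(_ K) K_nd _ _; rewrite /nondegenerate_simplex.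
have -> : simplex_mx (sorted_pt K)
        = row_perm (sort_perm K)^-1%g (simplex_mx (@pt _ _ M \o ltg K)).
  by apply/matrixP => i j; rewrite !mxE.
by rewrite row_permE unitmx_mul unitmx_perm.
Qed.

Lemma cell_vertsE K : cell_verts K = sorted_vtx K @: setT.
Proof.
apply/setP => g; apply/imsetP/imsetP => -[i _ ->].
  by exists (sort_perm K i); rewrite ?inE// /sorted_vtx permK.
by exists ((sort_perm K)^-1%g i).
Qed.

Lemma face_positions K F : F \subset cell_verts K ->
  F = sorted_vtx K @: (sorted_vtx K @^-1: F).
Proof.
move=> /fintype.subsetP F_K; apply/setP => g; apply/idP/imsetP => [gF|[j]].
  have := F_K g gF; rewrite cell_vertsE => /imsetP[j _ gE].
  by exists j => //; rewrite inE -gE.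
by rewrite inE => jF ->.
Qed.

Lemma big_face (V : nmodType) K F (h : 'I_(nvert M) -> V) :
  F \subset cell_verts K ->
  \sum_(g in F) h g
  = \sum_j (if sorted_vtx K j \in F then h (sorted_vtx K j) else 0).
Proof.
move=> F_K; rewrite {1}(face_positions F_K) big_imset /=; last first.
  by move=> i j _ _; apply: sorted_vtx_inj.
by rewrite -big_mkcond; apply: eq_bigl => j; rewrite inE.
Qed.

(** Both lists are strictly increasing and have the same members, hence coincide. *)
Lemma enum_face K f : [seq sorted_vtx K i | i <- enum f] = enum (sorted_vtx K @: f).
Proof.
apply: (irr_sorted_eq (leT := fun g h : 'I_(nvert M) => (g < h)%N)).
- by move=> ? ? ?; apply: ltn_trans.
- by move=> g; rewrite ltnn.
- rewrite sorted_map; apply: sub_sorted (enum_sorted f) => i j.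
  exact: sorted_vtx_ltn.
- rewrite [enum _]/(enum_mem _) /=.
  apply: sorted_filter; first by move=> ? ? ?; apply: ltn_trans.
  by have := iota_ltn_sorted 0 (nvert M); rewrite -val_enum_ord sorted_map enumT.
move=> g; rewrite mem_enum; apply/mapP/imsetP => -[i i_f ->]; exists i => //.
  by rewrite mem_enum in i_f.
by rewrite mem_enum.
Qed.

Lemma card_sorted_vtx K f : #|sorted_vtx K @: f| = #|f|.
Proof. by rewrite card_imset//; apply: sorted_vtx_inj. Qed.

(** By [enum_face], [f] and [f'] enumerate the same increasing list of vertices, and [sigma f f']
    preserves the rank in it. This is where sorting by global index makes the cells agree. *)
Lemma sigma_sorted_vtx K K' f f' i :
  sorted_vtx K @: f = sorted_vtx K' @: f' -> i \in f ->
  sorted_vtx K' (sigma f f' i) = sorted_vtx K i.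
Proof.
move=> ff' i_f; have ff'c : #|f| = #|f'|.
  by rewrite -(card_sorted_vtx K) ff' card_sorted_vtx.
have ix : (index i (enum f) < size (enum f))%N by rewrite index_mem mem_enum.
rewrite /sigma -(nth_map _ (sorted_vtx K' ord0)); last first.
  by rewrite -cardE -ff'c cardE.
rewrite enum_face -ff' -enum_face (nth_map ord0)// nth_index//.
by rewrite mem_enum.
Qed.

(** Combinations with coefficient sum 0 are closed under sums and scaling, so the generators are
    enough. *)
Lemma tangentP F (t : 'rV[R]_D) : t \in tangent F ->
  exists2 d : 'I_(nvert M) -> R,
    \sum_(g in F) d g = 0 & t = \sum_(g in F) d g *: pt g.
Proof.
rewrite /tangent; set X := (X in <<X>>%VS); rewrite (_ : X = in_tuple X)//.
move=> /coord_span ->.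
pose P (u : 'rV[R]_D) := exists2 d : 'I_(nvert M) -> R,
    \sum_(g in F) d g = 0 & u = \sum_(g in F) d g *: pt g.
apply: (big_ind P) => [|_ _ [a a0 ->] [b b0 ->]|i _].
- by exists (fun=> 0); rewrite big1// => g _; rewrite scale0r.
- exists (fun g => a g + b g); first by rewrite big_split/= a0 b0 addr0.
  by rewrite -big_split; apply: eq_bigr => g _; rewrite scalerDl.
have [d d0 ->] : P X`_i.
  have : X`_i \in X by rewrite mem_nth.
  move=> /allpairsP[[g h] /= [gF hF ->]]; rewrite !mem_enum in gF hF.
  have delta (V : lmodType R) (k : 'I_(nvert M)) (w : 'I_(nvert M) -> V) :
      k \in F -> \sum_(l in F) (l == k)%:R *: w l = w k.
    move=> kF; rewrite (bigD1 k)//= eqxx scale1r big1 ?addr0// => l /andP[_].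
    by move=> /negbTE ->; rewrite scale0r.
  (* The difference of the indicators of [g] and [h] represents [pt g - pt h], also when [g = h]. *)
  exists (fun l => (l == g)%:R - (l == h)%:R).
    have delta1 k : k \in F -> \sum_(l in F) (l == k)%:R = 1 :> R.
      move=> kF; rewrite -[RHS](delta R^o k (fun=> 1) kF).
      by apply: eq_bigr => l _; rewrite -[RHS]/(_ * _) mulr1.
    by rewrite sumrB !delta1// subrr.
  under eq_bigr do rewrite scalerBl.
  by rewrite sumrB !delta.
exists (fun g => coord (in_tuple X) i t * d g).
  by rewrite -mulr_sumr d0 mulr0.
by rewrite scaler_sumr; apply: eq_bigr => g _; rewrite scalerA.
Qed.

End SortedVertices.

(** * Traces of rotated functions *)

Section Rotated.
Variables (R : realType) (D r : nat) (M : mesh R D).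
Variables (v : 'I_D.+1 -> 'rV[R]_D) (fam : form_family).
Hypothesis v_nd : nondegenerate_simplex v.
Hypothesis M_conf : conforming_mesh M.
Implicit Types (K : cell M) (F : {set 'I_(nvert M)}).
Implicit Types (q : face_index D r fam).

(** Coefficients on the vertices of [F], extended by zero to all positions of [K]; for total 1 they
    are barycentric coordinates with respect to [sorted_pt K]. *)
Definition face_coord K F (c : 'I_(nvert M) -> R) (j : 'I_D.+1) : R :=
  if sorted_vtx K j \in F then c (sorted_vtx K j) else 0.

Lemma face_coord_sum K F c : F \subset cell_verts K ->
  \sum_(g in F) c g = \sum_j face_coord K F c j.
Proof. exact: (big_face M_conf). Qed.

Lemma face_coord_comb K F c : F \subset cell_verts K ->
  \sum_(g in F) c g *: pt g = \sum_j face_coord K F c j *: sorted_pt K j.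
Proof.
move=> F_K; rewrite (big_face M_conf _ F_K); apply: eq_bigr => j _.
by rewrite /face_coord; case: ifP => // _; rewrite scale0r.
Qed.

(** [PhiV K] preserves barycentric coordinates and its differential preserves theirs, so the
    pullback evaluates the reference form at the coefficients themselves. *)
Lemma rotatedE K F q (c d : 'I_(nvert M) -> R) : F \subset cell_verts K ->
  \sum_(g in F) c g = 1 -> \sum_(g in F) d g = 0 ->
  rotated v K q (\sum_(g in F) c g *: pt g) (\sum_(g in F) d g *: pt g)
  = coord_form (face_coord K F c) (face_coord K F d) q.1 q.2.
Proof.
move=> F_K; rewrite !(face_coord_sum _ F_K) !(face_coord_comb _ F_K) => c1 d0.
have K_nd := sorted_pt_nondegenerate M_conf K.
rewrite /rotated /pullback basis_formE diff_simplex_map /PhiV /simplex_map.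
apply: (congr2 (fun B T => coord_form B T q.1 q.2)); apply/funext => i.
  rewrite -[RHS](bary_coord _ v_nd c1); congr bary.
  by apply: eq_bigr => j _; rewrite bary_coord.
rewrite dbaryE -[RHS](bary_lin_coord _ v_nd d0); congr bary_lin.
by apply: eq_bigr => j _; rewrite bary_lin_coord.
Qed.

(** Points of the hull and vectors of the tangent space (by [tangentP]) are combinations of the
    vertices of [F] of the stated kind. *)
Lemma eq_trace F (w w' : oneform R D) :
  (forall c d : 'I_(nvert M) -> R,
     \sum_(g in F) c g = 1 -> \sum_(g in F) d g = 0 ->
     w (\sum_(g in F) c g *: pt g) (\sum_(g in F) d g *: pt g)
     = w' (\sum_(g in F) c g *: pt g) (\sum_(g in F) d g *: pt g)) ->
  trace F w = trace F w'.
Proof.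
move=> ww'; apply/funext => -[x xF]; apply/funext => t; rewrite /trace /=.
have [d d0 ->] := tangentP (subvsP t).
by case: xF => c [_ c1 ->]; apply: ww'.
Qed.

Lemma ownerE K q : owner K q = sorted_vtx K @: q.1.
Proof. by rewrite /owner -imset_comp. Qed.

Lemma basis_card q : q \in basis_indices D r fam -> (1 < #|q.1|)%N.
Proof.
rewrite !inE; case: q => f nu /=.
by case: fam nu => [[k al]|[[e1 e2] al]] /= /and5P[].
Qed.

(** At an owner vertex outside [F], the coordinate and its differential both vanish along [F], so
    [coord_form_eq0] applies. *)
Lemma trace_rotated_eq0 K F q : F \subset cell_verts K ->
  q \in basis_indices D r fam -> ~~ (owner K q \subset F) ->
  trace F (rotated v K q) = (fun _ _ => 0).
Proof.
move=> F_K qB; rewrite ownerE => /fintype.subsetPn[_ /imsetP[j j_q ->] jF].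
transitivity (trace F (fun _ _ => 0 : R)) => //.
apply: eq_trace => c d c1 d0; rewrite rotatedE//.
have [Bj Tj] : face_coord K F c j = 0 /\ face_coord K F d j = 0.
  by rewrite /face_coord (negbTE jF).
by apply: coord_form_eq0 Bj Tj; rewrite // inE in qB.
Qed.

Lemma trace_rotated_relabel K K' F q (f' : {set 'I_D.+1}) :
  F \subset cell_verts K -> F \subset cell_verts K' ->
  q \in basis_indices D r fam -> owner K q = sorted_vtx K' @: f' ->
  trace F (rotated v K q) = trace F (rotated v K' (f', relabel q.1 f' q.2)).
Proof.
move=> F_K F_K' qB; rewrite ownerE => own.
have card_eq : #|q.1| = #|f'|.
  by rewrite -(card_sorted_vtx M_conf K) own card_sorted_vtx.
apply: eq_trace => c d c1 d0; rewrite !rotatedE//=; apply/esym.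
apply: coord_form_relabel => // [|i i_q|i i_q]; first by rewrite inE in qB.
  by rewrite /face_coord (sigma_sorted_vtx M_conf own i_q).
by rewrite /face_coord (sigma_sorted_vtx M_conf own i_q).
Qed.

(** * Identification through the position map *)

Variable p : {set 'I_D.+1} -> nu_index D r fam -> nat.
Hypothesis p_pos : position_map p.

(** The owner fixes the face, as [sorted_vtx K'] is injective. The position then fixes the index:
    [p f'] is injective on the basis indices of [f'] and takes the required value at the relabelled
    index. *)
Lemma identifiedP K K' q (f' : {set 'I_D.+1}) q' :
  q \in basis_indices D r fam -> owner K q = sorted_vtx K' @: f' ->
  q' \in basis_indices D r fam /\ identified p K q K' q'
  <-> q' = (f', relabel q.1 f' q.2).
Proof.
move=> qB own; have q_gt1 := basis_card qB.
have card_eq : #|q.1| = #|f'|.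
  by rewrite -(card_sorted_vtx M_conf K) -ownerE own card_sorted_vtx.
have q1B : q.2 \in basis_at r fam q.1 by rewrite inE in qB.
have relB := relabel_basis card_eq q1B.
case: p_pos => p_bij p_rel; rewrite /identified own ownerE.
split=> [[]|->]; last by rewrite inE /= relB eqxx p_rel ?eqxx.
case: q' => f nu; rewrite inE /= => nuB /andP[/eqP/imset_inj fE /eqP pE].
have ff' : f = f' by apply/esym/fE/(sorted_vtx_inj M_conf).
rewrite ff' in nuB pE *.
have f'_gt1 : (1 < #|f'|)%N by rewrite -card_eq.
have [_ p_inj _] := p_bij _ f'_gt1.
congr pair; apply: p_inj; rewrite ?in_setE//.
by rewrite -pE p_rel.
Qed.

Lemma trace_identified K K' F q q' :
  F \subset cell_verts K -> F \subset cell_verts K' ->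
  q \in basis_indices D r fam -> q' \in basis_indices D r fam ->
  identified p K q K' q' ->
  trace F (rotated v K q) = trace F (rotated v K' q').
Proof.
move=> F_K F_K' qB q'B id_qq'; have /andP[/eqP] := id_qq'.
rewrite (ownerE K') => own _.
have /(_ (conj q'B id_qq')) -> := (identifiedP q' qB own).1.
exact: trace_rotated_relabel.
Qed.

(** The owner lies in [F], hence in [K']; its set of positions there is the face of the partner. *)
Lemma identified_exists K K' F q : F \subset cell_verts K' ->
  q \in basis_indices D r fam -> owner K q \subset F ->
  exists q', unique (fun q'' => q'' \in basis_indices D r fam /\
                                identified p K q K' q'') q'.
Proof.
move=> F_K' qB qF; have own := face_positions (fintype.subset_trans qF F_K').
set f' := _ @^-1: _ in own; exists (f', relabel q.1 f' q.2); split.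
  exact/(identifiedP _ qB own).
by move=> q'' /(identifiedP _ qB own).
Qed.

Lemma identified_sym_trans K0 q0 K q K' q' :
  identified p K0 q0 K q -> identified p K q K' q' = identified p K0 q0 K' q'.
Proof. by rewrite /identified => /andP[/eqP-> /eqP->]. Qed.

(** If the owner of [q] lay in [F], then [q] would have a partner in [K'], and that partner would
    also be identified with [q0]. So the owner is not in [F] and the trace vanishes. *)
Lemma trace_unmatched K0 q0 K K' F q :
  F \subset cell_verts K -> F \subset cell_verts K' ->
  q \in basis_indices D r fam -> identified p K0 q0 K q ->
  (forall q', ~~ ((q' \in basis_indices D r fam) && identified p K0 q0 K' q')) ->
  trace F (rotated v K q) = (fun _ _ => 0).
Proof.
move=> F_K F_K' qB id_q no; apply: trace_rotated_eq0 => //.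
apply/negP => /(identified_exists F_K' qB)[q' [[q'B id_q'] _]].
by have := no q'; rewrite q'B -(identified_sym_trans _ _ id_q) id_q'.
Qed.

(** If both cells carry a function identified with [q0], these two are identified with each other.
    If only one does, its trace is zero like the extension by zero on the other cell. *)
Lemma trace_global_basis K0 q0 K K' F :
  F \subset cell_verts K -> F \subset cell_verts K' ->
  trace F (global_basis v p K0 q0 K) = trace F (global_basis v p K0 q0 K').
Proof.
move=> F_K F_K'; rewrite /global_basis.
case: pickP => [q /andP[qB id_q]|no]; case: pickP => [q' /andP[q'B id_q']|no'].
- by apply: trace_identified => //; rewrite (identified_sym_trans _ _ id_q).
- by rewrite (trace_unmatched F_K F_K' qB id_q)// => q'; apply/negbT/no'.
- by rewrite (trace_unmatched F_K' F_K q'B id_q')// => q; apply/negbT/no.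
- by [].
Qed.

End Rotated.

Theorem corollary8 (R : realType) (D r : nat) (v : 'I_D.+1 -> 'rV[R]_D)
    (fam : form_family) (M : mesh R D)
    (p : {set 'I_D.+1} -> nu_index D r fam -> nat) :
  (1 <= D)%N -> (1 <= r)%N -> nondegenerate_simplex v ->
  conforming_mesh M -> position_map p ->
  (forall (Kp Km : cell M) (F : {set 'I_(nvert M)}),
     Kp != Km -> shared_face F Kp Km ->
     [/\ (forall (q : face_index D r fam) (G : {set 'I_(nvert M)}),
            q \in basis_indices D r fam -> owner Kp q = G -> G \subset F ->
            exists q' : face_index D r fam,
              unique (fun q'' => q'' \in basis_indices D r fam /\
                                 identified p Kp q Km q'') q' /\
              owner Km q' = G),
         (forall (qp qm : face_index D r fam) (G : {set 'I_(nvert M)}),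
            qp \in basis_indices D r fam -> qm \in basis_indices D r fam ->
            identified p Kp qp Km qm ->
            owner Kp qp = G -> owner Km qm = G -> G \subset F ->
            trace F (rotated v Kp qp) = trace F (rotated v Km qm))
       & (forall (K : cell M) (q : face_index D r fam),
            K = Kp \/ K = Km -> q \in basis_indices D r fam ->
            ~~ (owner K q \subset F) ->
            trace F (rotated v K q) = (fun _ _ => 0%R))]) /\
  HLambda1_conforming (assembled M v p).
Proof.
move=> _ _ v_nd M_conf p_pos; split.
  move=> Kp Km F _ [_ F_Kp F_Km]; split.
  - move=> q G qB <- qF.
    have [q' q'P] := identified_exists M_conf p_pos F_Km qB qF.
    by exists q'; split => //; case: q'P => -[_ /andP[/eqP <-]].
  - move=> qp qm G qpB qmB id_q _ _ _.
    exact: trace_identified id_q.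
  - by move=> K q KE qB; apply: trace_rotated_eq0 => //; case: KE => ->.
move=> u [c ->] K K' F _ [_ F_K F_K'].
apply/funext => x; apply/funext => t; rewrite /trace; cbv beta.
(* Both components of [u] use the same coefficients [c], so agreement for each global basis function
   suffices. *)
have trE K0 q0 : global_basis v p K0 q0 K (sval x) (vsval t)
               = global_basis v p K0 q0 K' (sval x) (vsval t).
  have := trace_global_basis v_nd M_conf p_pos K0 q0 F_K F_K'.
  by move/(congr1 (fun w => w x t)); rewrite /trace.
by apply: eq_bigr => K0 _; apply: eq_bigr => q0 _; rewrite trE.
Qed.
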